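(* Let $V$ be an $\ell$-Volterra quadratic stochastic operator on $S^{m-1}$ with associated coefficients $a_{ki}$. If there exist $p\in\{1,\dots,\ell\}$ and $q\in E$ such that $a_{pi}-a_{qi}\le 0$ for any $i\in E$, then $$f_{pq}(x)=\frac{x_p}{x_q},\qquad x=(x_1,\dots,x_m)\in\mathrm{int}\,S^{m-1},$$ is a Lyapunov function for the dynamical system generated by $V$. Moreover, $f_{pq}(x)$ is monotonically decreasing along the trajectory $\{x^{(n)}\}$, where $x^0\in\mathrm{int}\,S^{m-1}$ and $x^0\ne V(x^0)$.
   Context: Let $E=\{1,\dots,m\}$, $S^{m-1}=\{x=(x_1,\dots,x_m)\in\mathbb{R}^m: x_i\ge 0,\ \sum_{i=1}^m x_i=1\}$ and $\mathrm{int}\,S^{m-1}=\{x\in S^{m-1}:\prod_{i=1}^m x_i>0\}$. A quadratic stochastic operator is a map $V:S^{m-1}\to S^{m-1}$, $V(x)_k=\sum_{i,j=1}^m P_{ij,k}x_ix_j$ for $k=1,\dots,m$, where $P_{ij,k}\ge 0$, $P_{ij,k}=P_{ji,k}$ and $\sum_{k=1}^m P_{ij,k}=1$ for all $i,j,k\in E$. For a fixed $\ell\in E$, $V$ is called $\ell$-Volterra if (i) $P_{ij,k}=0$ whenever $k\in\{1,\dots,\ell\}$, $i,j\in E$ and $k\notin\{i,j\}$; and (ii) for every $k\in\{\ell+1,\dots,m\}$ there is at least one pair $(i,j)$ with $i\ne k$, $j\ne k$ and $P_{ij,k}>0$. Its associated coefficients are $a_{ki}=2P_{ik,k}-1$ for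 $k\ne i$ and $a_{kk}=P_{kk,k}-1$ ($k,i\in E$). With these, $V(x)_k=x_k\left(1+\sum_{i=1}^m a_{ki}x_i\right)$ for $k=1,\dots,\ell$, and $V(x)_k=x_k\left(1+\sum_{i=1}^m a_{ki}x_i\right)+\sum_{i\ne k,\,j\ne k}P_{ij,k}x_ix_j$ for $k=\ell+1,\dots,m$. The trajectory $\{x^{(n)}\}$ of an initial point $x^0$ is given by $x^{(0)}=x^0$, $x^{(n+1)}=V(x^{(n)})$, $n=0,1,2,\dots$. A continuous function $\varphi:\mathrm{int}\,S^{m-1}\to\mathbb{R}$ is called a Lyapunov function for the dynamical system generated by $V$ if the limit $\lim_{n\to\infty}\varphi(x^{(n)})$ exists for any initial point $x^0$. *)

(* Defs.v *)
From HB Require Import structures.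
From mathcomp Require Import all_boot all_order all_algebra.
From mathcomp Require Import all_classical all_reals all_analysis.

Set Implicit Arguments.
Unset Strict Implicit.
Unset Printing Implicit Defensive.

Import Order.TTheory GRing.Theory Num.Theory.
Import numFieldNormedType.Exports.

Local Open Scope classical_set_scope.
Local Open Scope ring_scope.

(* The index set {1, ..., m} is 'I_m, so k in {1, ..., l} reads (k < l)%N and
   k in {l+1, ..., m} reads (l <= k)%N. *)

Definition simplex (R : realType) (m : nat) : set 'rV[R]_m :=
  [set x | (forall i, 0 <= x ord0 i) /\ \sum_i x ord0 i = 1].

Definition int_simplex (R : realType) (m : nat) : set 'rV[R]_m :=
  [set x | simplex x /\ 0 < \prod_i x ord0 i].

(* P i j k stands for P_{ij,k}. *)
Definition qso_coeffs (R : realType) (m : nat)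
    (P : 'I_m -> 'I_m -> 'I_m -> R) : Prop :=
  [/\ forall i j k, 0 <= P i j k,
      forall i j k, P i j k = P j i k &
      forall i j, \sum_k P i j k = 1].

(* Defined on all of R^m; it preserves the simplex when qso_coeffs P holds. *)
Definition qso (R : realType) (m : nat) (P : 'I_m -> 'I_m -> 'I_m -> R)
    (x : 'rV[R]_m) : 'rV[R]_m :=
  \row_k \sum_i \sum_j P i j k * x ord0 i * x ord0 j.

Definition l_volterra (R : realType) (m : nat) (l : nat)
    (P : 'I_m -> 'I_m -> 'I_m -> R) : Prop :=
  (forall k i j : 'I_m, (k < l)%N -> k \notin [:: i; j] -> P i j k = 0) /\
  (forall k : 'I_m, (l <= k)%N ->
     exists i j : 'I_m, [/\ i != k, j != k & 0 < P i j k]).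

Definition assoc_coeff (R : realType) (m : nat)
    (P : 'I_m -> 'I_m -> 'I_m -> R) (k i : 'I_m) : R :=
  if k == i then P k k k - 1 else 2 * P i k k - 1.

Definition trajectory (R : realType) (m : nat)
    (V : 'rV[R]_m -> 'rV[R]_m) (x0 : 'rV[R]_m) (n : nat) : 'rV[R]_m :=
  iter n V x0.

(* phi is given by a total function, but continuity is only required on the
   interior of the simplex, where initial points are taken. *)
Definition lyapunov (R : realType) (m : nat)
    (V : 'rV[R]_m -> 'rV[R]_m) (phi : 'rV[R]_m -> R) : Prop :=
  {within @int_simplex R m, continuous phi} /\
  (forall x0 : 'rV[R]_m, int_simplex x0 ->
     cvg (phi (trajectory V x0 n) @[n --> \oo])).

(* A trajectory started in the interior can reach the boundary, where division
   by zero yields 0.  Under the hypothesis a_{pi} <= a_{qi}, x_q can only vanish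
   along such a trajectory once x_p has vanished too, and x_p then stays 0, so
   the convention only ever affects the quotient 0 / 0. *)
Definition coord_ratio (R : realType) (m : nat) (p q : 'I_m)
    (x : 'rV[R]_m) : R :=
  x ord0 p / x ord0 q.

(* Main.v *)
Require Import Defs.
From mathcomp Require Import all_boot all_order all_algebra.
From mathcomp Require Import all_classical all_reals all_analysis.
From mathcomp Require Import ring.

(** For [x] in the simplex write [V(x)_k = x_k * S_k(x) + r_k(x)], where
    [S_k(x) = \sum_i (1 + a_{ki}) x_i >= 0] collects the terms that contain
    [x_k] and [r_k(x) >= 0] those that do not ([qso_growth_split]).  The
    Volterra condition says that [r_p = 0], and [a_{pi} <= a_{qi}] says that
    [S_p <= S_q].  Hence any bound [x_p <= C x_q] with [C >= 0] is propagated: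
    [V(x)_p = x_p S_p <= C x_q S_q <= C V(x)_q] ([qso_preserves_bound]).

    Taking [C = x_p / x_q] shows that the ratio does not increase in one step.
    The argument is phrased with the product bound rather than with the
    quotient because [x_q] may vanish along the trajectory: the case [x_q = 0]
    is harmless as soon as it forces [x_p = 0], and this implication is itself
    propagated by the bound ([coord_ratio_step]).  So the ratio is
    nonincreasing and nonnegative along every interior trajectory, and it
    converges.  It is continuous on the interior since [x_q > 0] there. *)

Import Order.TTheory GRing.Theory Num.Theory.
Import numFieldNormedType.Exports.

Local Open Scope classical_set_scope.
Local Open Scope ring_scope.

Set Implicit Arguments.
Unset Strict Implicit.

Lemma int_simplex_gt0 (R : realType) (m : nat) (x : 'rV[R]_m) (i : 'I_m) :
  int_simplex x -> 0 < x ord0 i.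
Proof.
move=> [[x_ge0 _] prod_gt0]; rewrite lt_neqAle x_ge0 andbT eq_sym.
by move: (lt0r_neq0 prod_gt0) => /prodf_neq0 /(_ i isT).
Qed.

Lemma qso_simplex (R : realType) (m : nat) (P : 'I_m -> 'I_m -> 'I_m -> R)
    (x : 'rV[R]_m) :
  qso_coeffs P -> simplex x -> simplex (qso P x).
Proof.
move=> [P_ge0 _ P_sum1] [x_ge0 x_sum1]; split=> [k|].
  rewrite mxE; apply: sumr_ge0 => i _; apply: sumr_ge0 => j _.
  by rewrite !mulr_ge0.
under eq_bigr do rewrite mxE.
rewrite exchange_big /= -[RHS]x_sum1; apply: eq_bigr => i _.
rewrite exchange_big /= -[RHS]mulr1 -x_sum1 mulr_sumr; apply: eq_bigr => j _.
by rewrite -!mulr_suml P_sum1 mul1r.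
Qed.

Lemma assoc_coeff_geN1 (R : realType) (m : nat)
    (P : 'I_m -> 'I_m -> 'I_m -> R) (k i : 'I_m) :
  qso_coeffs P -> 0 <= 1 + assoc_coeff P k i.
Proof.
move=> [P_ge0 _ _]; rewrite /assoc_coeff.
by case: ifP => _; rewrite subrKC ?mulr_ge0.
Qed.

(** The coefficient [2 P_{ik,k}] in [a_{ki}] comes from the two symmetric
    occurrences of the pair [{i, k}], whereas [{k, k}] occurs only once. *)
Lemma qso_growth_split (R : realType) (m : nat)
    (P : 'I_m -> 'I_m -> 'I_m -> R) (x : 'rV[R]_m) (k : 'I_m) :
  qso_coeffs P ->
  qso P x ord0 k =
    x ord0 k * (\sum_i (1 + assoc_coeff P k i) * x ord0 i) +
    \sum_(i | i != k) \sum_(j | j != k) P i j k * x ord0 i * x ord0 j.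
Proof.
move=> [_ P_sym _]; rewrite mxE (bigD1 k) //= (bigD1 k) //=.
under [X in _ + _ + X]eq_bigr do rewrite (bigD1 k) //=.
rewrite big_split /= [in RHS](bigD1 k) //= !addrA; congr (_ + _).
rewrite mulrDr mulr_sumr -addrA -big_split /= /assoc_coeff eqxx subrKC.
congr (_ + _); first by rewrite mulrC.
apply: eq_bigr => i /negPf; rewrite eq_sym => ->.
by rewrite subrKC (P_sym k i); ring.
Qed.

Lemma qso_ge_growth (R : realType) (m : nat)
    (P : 'I_m -> 'I_m -> 'I_m -> R) (x : 'rV[R]_m) (k : 'I_m) :
  qso_coeffs P -> simplex x ->
  x ord0 k * (\sum_i (1 + assoc_coeff P k i) * x ord0 i) <= qso P x ord0 k.
Proof.
move=> hP [x_ge0 _]; have [P_ge0 _ _] := hP.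
rewrite qso_growth_split // lerDl.
by apply: sumr_ge0 => i _; apply: sumr_ge0 => j _; rewrite !mulr_ge0.
Qed.

Lemma qso_volterra_coord (R : realType) (m l : nat)
    (P : 'I_m -> 'I_m -> 'I_m -> R) (x : 'rV[R]_m) (k : 'I_m) :
  qso_coeffs P -> l_volterra l P -> (k < l)%N ->
  qso P x ord0 k = x ord0 k * (\sum_i (1 + assoc_coeff P k i) * x ord0 i).
Proof.
move=> hP [P_eq0 _] kl; rewrite qso_growth_split // [X in _ + X]big1 ?addr0 //.
move=> i ik; apply: big1 => j jk; rewrite P_eq0 ?mul0r //.
by rewrite !inE negb_or eq_sym ik eq_sym.
Qed.

(** The cone [x_p <= C x_q] is invariant, since [x_p] is multiplied by a
    smaller factor than [x_q] and only [x_q] may receive further mass. *)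
Lemma qso_preserves_bound (R : realType) (m l : nat)
    (P : 'I_m -> 'I_m -> 'I_m -> R) (p q : 'I_m) (x : 'rV[R]_m) (C : R) :
  qso_coeffs P -> l_volterra l P -> (p < l)%N ->
  (forall i, assoc_coeff P p i - assoc_coeff P q i <= 0) ->
  simplex x -> 0 <= C -> x ord0 p <= C * x ord0 q ->
  qso P x ord0 p <= C * qso P x ord0 q.
Proof.
move=> hP hV pl hpq hx C_ge0 x_le; have [x_ge0 _] := hx.
rewrite (qso_volterra_coord x hP hV pl).
apply: le_trans (ler_wpM2l C_ge0 (qso_ge_growth q hP hx)).
rewrite mulrA; apply: ler_pM => //.
  by apply: sumr_ge0 => i _; rewrite mulr_ge0 ?assoc_coeff_geN1.
by apply: ler_sum => i _; rewrite ler_wpM2r // lerD2l -subr_le0.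
Qed.

(** The bound [x_p <= (x_p / x_q) x_q] holds even at [x_q = 0] when [x_p]
    vanishes there, so this implication is the right induction invariant. *)
Lemma coord_ratio_step (R : realType) (m l : nat)
    (P : 'I_m -> 'I_m -> 'I_m -> R) (p q : 'I_m) (x : 'rV[R]_m) :
  qso_coeffs P -> l_volterra l P -> (p < l)%N ->
  (forall i, assoc_coeff P p i - assoc_coeff P q i <= 0) ->
  simplex x -> (x ord0 q = 0 -> x ord0 p = 0) ->
  coord_ratio p q (qso P x) <= coord_ratio p q x /\
  (qso P x ord0 q = 0 -> qso P x ord0 p = 0).
Proof.
move=> hP hV pl hpq hx xq0; have [x_ge0 _] := hx.
have [y_ge0 _] := qso_simplex hP hx.
have r_ge0 : 0 <= coord_ratio p q x by rewrite divr_ge0.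
have x_le : x ord0 p <= coord_ratio p q x * x ord0 q.
  have [xq|xq] := eqVneq (x ord0 q) 0; first by rewrite xq0 // xq mulr0.
  by rewrite divfK.
have y_le := qso_preserves_bound hP hV pl hpq hx r_ge0 x_le.
split=> [|yq]; last first.
  by move: y_le; rewrite yq mulr0 => yp; apply/le_anti; rewrite yp y_ge0.
rewrite {1}/coord_ratio; have [yq|yq] := eqVneq (qso P x ord0 q) 0.
  by rewrite yq invr0 mulr0.
by rewrite ler_pdivrMr // lt_neqAle eq_sym yq y_ge0.
Qed.

Lemma trajectory_invariant (R : realType) (m l : nat)
    (P : 'I_m -> 'I_m -> 'I_m -> R) (p q : 'I_m) (x0 : 'rV[R]_m) (n : nat) :
  qso_coeffs P -> l_volterra l P -> (p < l)%N ->
  (forall i, assoc_coeff P p i - assoc_coeff P q i <= 0) ->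
  int_simplex x0 ->
  simplex (trajectory (qso P) x0 n) /\
  (trajectory (qso P) x0 n ord0 q = 0 -> trajectory (qso P) x0 n ord0 p = 0).
Proof.
move=> hP hV pl hpq hx0; elim: n => [|n [hx xq0]].
  split; first by case: hx0.
  by move=> xq; have := int_simplex_gt0 q hx0; rewrite xq ltxx.
split; first exact: qso_simplex.
by have [] := coord_ratio_step hP hV pl hpq hx xq0.
Qed.

Lemma coord_ratio_trajectory_nonincreasing (R : realType) (m l : nat)
    (P : 'I_m -> 'I_m -> 'I_m -> R) (p q : 'I_m) (x0 : 'rV[R]_m) :
  qso_coeffs P -> l_volterra l P -> (p < l)%N ->
  (forall i, assoc_coeff P p i - assoc_coeff P q i <= 0) ->
  int_simplex x0 ->
  nonincreasing_seq
    (fun n : nat => coord_ratio p q (trajectory (qso P) x0 n)).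
Proof.
move=> hP hV pl hpq hx0; apply/nonincreasing_seqP => n.
have [hx xq0] := trajectory_invariant n hP hV pl hpq hx0.
by have [] := coord_ratio_step hP hV pl hpq hx xq0.
Qed.

Lemma coord_ratio_continuous (R : realType) (m : nat) (p q : 'I_m) :
  {within @int_simplex R m, continuous (coord_ratio p q)}.
Proof.
apply: continuous_in_subspaceT => x; rewrite inE => hx.
have coordC i : (fun y : 'rV[R]_m => y ord0 i) @ x --> x ord0 i.
  exact: (@coord_continuous R 1 m ord0 i x).
apply: (cvgM (coordC p)); apply: cvgV (coordC q).
by rewrite gt_eqF // int_simplex_gt0.
Qed.

Unset Implicit Arguments.
Set Strict Implicit.
Local Close Scope classical_set_scope.

Theorem theorem4 (R : realType) (m l : nat) (P : 'I_m -> 'I_m -> 'I_m -> R)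
    (hl : (0 < l <= m)%N) (hP : qso_coeffs P) (hV : l_volterra l P)
    (p q : 'I_m) (hp : (p < l)%N)
    (hpq : forall i : 'I_m, assoc_coeff P p i - assoc_coeff P q i <= 0) :
  lyapunov (qso P) (coord_ratio p q) /\
  (forall x0 : 'rV[R]_m, int_simplex x0 -> x0 <> qso P x0 ->
     nonincreasing_seq
       (fun n : nat => coord_ratio p q (trajectory (qso P) x0 n))).
Proof.
have ratio_noninc x0 :=
  @coord_ratio_trajectory_nonincreasing R m l P p q x0 hP hV hp hpq.
split; last by move=> x0 hx0 _; exact: ratio_noninc.
split=> [|x0 hx0]; first exact: coord_ratio_continuous.
apply: nonincreasing_is_cvgn; first exact: ratio_noninc.
exists 0 => _ [n _ <-].
have [[x_ge0 _] _] := trajectory_invariant n hP hV hp hpq hx0.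
by rewrite divr_ge0.
Qed.
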